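(* Let $k\geq 2$ be an integer. If $G$ is an $n$-vertex graph that does not contain any non-empty $k$-divisible subgraph, then $e(G)\leq \left(q\left(\tfrac{3k}{2}\right)-1\right)n$. Moreover, if $k$ is odd, then $e(G)\leq (q(k)-1)n$.
   Context: All graphs are finite and simple; $e(G)$ denotes the number of edges of $G$. A graph $H$ is $k$-divisible if $d_H(u)\equiv 0 \pmod k$ for every $u\in V(H)$. A graph is non-empty if it has at least one edge. Subgraphs are not necessarily induced. For a positive real number $x$, $q(x)$ denotes the smallest prime number that is greater than or equal to $x$. *)

(* Defs.v *)
From mathcomp Require Import all_boot all_order all_algebra.
From mathcomp Require Import reals.

Set Implicit Arguments.
Unset Strict Implicit.
Unset Printing Implicit Defensive.

Import Order.TTheory GRing.Theory Num.Theory.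

(* A finite simple graph whose vertices are taken from a finite ambient type;
   its vertex set may be a proper subset of [T], so that a graph and its
   (not necessarily spanning or induced) subgraphs have the same type.
   Edges are unordered pairs of distinct vertices. *)
Record graph (T : finType) := Graph {
  vertices : {set T};
  edges : {set {set T}};
  edgesP : {in edges, forall f : {set T}, f \subset vertices /\ #|f| = 2}
}.

Definition num_edges (T : finType) (G : graph T) : nat := #|edges G|.

Definition degree (T : finType) (G : graph T) (u : T) : nat :=
  #|[set f in edges G | u \in f]|.

Definition subgraph (T : finType) (H G : graph T) : Prop :=
  vertices H \subset vertices G /\ edges H \subset edges G.

Definition nonempty_graph (T : finType) (G : graph T) : Prop :=
  edges G != set0.

Definition divisible_graph (T : finType) (k : nat) (H : graph T) : Prop :=
  forall u : T, u \in vertices H -> degree H u = 0 %[mod k].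

Lemma ex_prime_ge (R : realType) (x : R) :
  exists p : nat, prime p && (x <= p%:R)%R.
Proof.
have [p lt_p pr_p] := prime_above (Num.truncn x).+1.
exists p; rewrite pr_p /=; apply: ltW; apply: lt_trans (truncnS_gt x) _.
by rewrite ltr_nat.
Qed.

Definition next_prime (R : realType) (x : R) : nat := ex_minn (ex_prime_ge x).

(* Main.v *)
Require Import Defs.
From mathcomp Require Import all_boot all_order all_algebra.
From mathcomp Require Import reals.
From mathcomp Require Import zify ring.

Set Implicit Arguments.
Unset Strict Implicit.
Unset Printing Implicit Defensive.
Import Order.TTheory GRing.Theory Num.Theory.

(** Why the theorem is true. Let q be an odd prime with k <= q, and suppose
    that k is odd or that 3k <= 2q; the primes of the theorem satisfy this.
    A graph with more than (q - 1)n edges is shown to have a non-empty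
    k-divisible subgraph in two steps.

    First, it has a non-empty q-divisible set S of edges
    ([exists_divisible_subset]). Weight every set S of edges by (-1)^|S| times
    the product, over all vertices v and all nonzero residues a modulo q, of
    a - d_S(v). The product has (q - 1)n factors, each affine in the indicator
    of S, so that it has too small a degree for the signed sum over all S to
    be nonzero ([alternating_sum_eq0]). The empty set contributes a nonzero
    term, hence so does another set, and that set is q-divisible.

    Second, a q-divisible graph h with an edge has a k-divisible subgraph with
    an edge ([divisible_subgraph_exists]). Let theta = k/q. One would like a
    subgraph in which every degree d(v) drops to theta d(v). Such subgraphs are
    the perfect matchings of a gadget graph: v is blown up into d(v) ports, one
    for each edge at v, and c(v) = (1 - theta)d(v) cores; each core is joined
    to all the ports of its vertex, and the two ports of an edge are joined. A
    matching edge between two ports means that the edge is kept; the ports that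
    are matched to cores are discarded. The weight theta on port-port edges and
    1/d(v) on core-port edges gives total weight 1 at each node of the gadget.

    Now decompose the gadget into a set A and blocks that are odd and
    factor-critical, without edges between distinct blocks, such that A
    satisfies the condition of Hall's theorem with respect to the blocks
    ([critical_decomposition_exists]). All edges that leave a block go to A.
    If a family of blocks has boundaries of weight at least 1 each, then it has
    at least as many neighbours in A as members, because the weights at a node
    of A sum to 1 ([fractional_hall]). Therefore all blocks can be matched into
    A, except for some light blocks, whose boundary weighs less than 1
    ([match_up_to_good]). If the boundary of an odd block is lighter than 1,
    then each vertex has none or all of its cores in the block, and the weight
    is theta l + (1 - theta)m, where l counts the ports in the block whose
    partner is outside and m counts the ports that are separated from the cores
    of their vertex ([boundary_dichotomy]). Parity decides.
    - If k is odd then l is odd, so a light block has m = 0 and is a union of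
      complete gadgets. The vertices of the unmatched blocks are simply dropped
      from the subgraph; all other vertices get degree theta d(v)
      ([divisible_of_odd]).
    - If k is even then m is odd, and theta <= 2/3 makes every block with
      m >= 3 heavy, so a light block has m = 1 and l = 0: it is one side of
      a bridge, up to one port. Removing a suitable node from this
      factor-critical block leaves a perfect matching that yields the subgraph
      on that side of the bridge ([divisible_of_even]). *)

(** * Involutions and the marriage theorem *)

Lemma even_card_involution (T : finType) (K : {set T}) (m : T -> T) :
    {in K, forall x, [/\ m x \in K, m x != x & m (m x) = x]} ->
  ~~ odd #|K|.
Proof.
have [N] := ubnP #|K|; elim: N K => // N IHN K ltKN mK.
have [->|[x xK]] := set_0Vmem K; first by rewrite cards0.
have [mxK mx_x mmx] := mK x xK.
have mxKx : m x \in K :\ x by rewrite !inE mx_x.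
rewrite (cardsD1 x) xK (cardsD1 (m x)) mxKx /= negbK.
apply: IHN => [|y].
  by rewrite (cardsD1 x) xK (cardsD1 (m x)) mxKx in ltKN; lia.
rewrite !inE => /and3P[y_mx y_x yK]; have [myK my_y mmy] := mK y yK.
split=> //; rewrite myK andbT; apply/andP; split.
  by apply: contraNneq y_x => /(congr1 m); rewrite mmy mmx => ->.
by apply: contraNneq y_mx => <-; rewrite mmy.
Qed.

(** Hall's theorem, by the argument of Halmos and Vaughan: if a proper subset
    is tight, match it and its complement separately; otherwise there is slack
    everywhere and one pair can be matched greedily. The matching takes values
    in [option J] so that it is a total function even when [J] is empty. *)
Theorem hall_marriage (I J : finType) (D : {set I}) (R : I -> J -> bool) :
    (forall S : {set I}, S \subset D ->
       #|S| <= #|[set j | [exists i in S, R i j]]|) ->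
  exists f : I -> option J,
    {in D &, injective f} /\ {in D, forall i, exists2 j, f i = Some j & R i j}.
Proof.
have [N] := ubnP #|D|; elim: N D R => // N IHN D R ltDN hallD.
have [->|[i0 i0D]] := set_0Vmem D.
  by exists (fun=> None); split=> [i|i]; rewrite inE.
case: (boolP [exists S : {set I},
    [&& S \subset D, S != set0, S != D
      & #|[set j | [exists i in S, R i j]]| <= #|S|]]).
  move=> /existsP[S /and4P[sSD S0 SnD tight]].
  have cardDS : #|S| + #|D :\: S| = #|D| by rewrite -(cardsID S D) (setIidPr sSD).
  have S_gt0 : 0 < #|S| by rewrite card_gt0.
  have DS_gt0 : 0 < #|D :\: S|.
    by rewrite card_gt0 setD_eq0; apply: contraNN SnD => sDS; rewrite eqEsubset sSD.
  set NS := [set j | _] in tight.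
  have [||f [injf Rf]] := IHN S R; first by lia.
    by move=> S' sS'; apply: hallD; apply: subset_trans sSD.
  have [||g [injg Rg]] := IHN (D :\: S) (fun i j => R i j && (j \notin NS)); first by lia.
    move=> S' sS'; have sS'D : S' \subset D by apply: subset_trans sS' (subsetDl _ _).
    have dis : S :&: S' = set0.
      apply/setP=> i; rewrite !inE; apply/negP=> /andP[iS iS'].
      by have := subsetP sS' i iS'; rewrite inE iS.
    have := hallD (S :|: S'); rewrite subUset sSD sS'D => /(_ isT).
    rewrite cardsU dis cards0 subn0.
    set N1 := [set j | _]; set N2 := [set j | _] => le1.
    have sub : N1 \subset NS :|: N2.
      apply/subsetP=> j; rewrite !inE => /existsP[i /andP[]].
      case/setUP=> [iS|iS'] Rij.
        by apply/orP; left; apply/existsP; exists i; rewrite iS.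
      case: (boolP [exists i in S, R i j]) => //= nj.
      by apply/existsP; exists i; rewrite iS' Rij.
    have := leq_trans (subset_leq_card sub) (leq_card_setU _ _); lia.
  have fNS i : i \in S -> exists2 j, f i = Some j & j \in NS.
    move=> iS; have [j fj Rij] := Rf i iS; exists j => //.
    by rewrite inE; apply/existsP; exists i; rewrite iS.
  have gNS i : i \in D -> i \notin S -> exists2 j, g i = Some j & R i j && (j \notin NS).
    by move=> iD iS; apply: Rg; rewrite inE iS.
  exists (fun i => if i \in S then f i else g i); split=> [i i' iD i'D|i iD].
    case: ifPn => iS; case: ifPn => i'S.
    - exact: injf.
    - have [j -> jN] := fNS i iS; have [j' -> /andP[_ j'N]] := gNS i' i'D i'S.
      by case=> jj'; rewrite -jj' jN in j'N.
    - have [j -> jN] := fNS i' i'S; have [j' -> /andP[_ j'N]] := gNS i iD iS.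
      by case=> jj'; rewrite jj' jN in j'N.
    by apply: injg; rewrite inE ?iS ?i'S.
  case: ifPn => iS; first exact: Rf.
  by have [j gj /andP[Rij _]] := gNS i iD iS; exists j.
move=> /existsPn slack.
have [j0 Rij0] : exists j, R i0 j.
  have := hallD [set i0]; rewrite sub1set i0D cards1 => /(_ isT).
  case/card_gt0P=> j; rewrite inE => /existsP[i /andP[/set1P-> Rij]].
  by exists j.
have [||f [injf Rf]] := IHN (D :\ i0) (fun i j => R i j && (j != j0)).
- by move: ltDN; rewrite (cardsD1 i0) i0D.
- move=> S sS; have sSD : S \subset D by apply: subset_trans sS (subsetDl _ _).
  have [->|S0] := eqVneq S set0; first by rewrite cards0.
  have := slack S; rewrite sSD S0 /=.
  have -> /= : S != D.
    apply: contraTneq i0D => <-; apply/negP=> /(subsetP sS).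
    by rewrite !inE eqxx.
  rewrite -ltnNge; set N1 := [set j | _]; set N2 := [set j | _] => lt1.
  have sub : N1 \subset j0 |: N2.
    apply/subsetP=> j; rewrite !inE => /existsP[i /andP[iS Rij]].
    case: eqVneq => //= jj0.
    by apply/existsP; exists i; rewrite iS Rij.
  have := subset_leq_card sub; rewrite cardsU1; case: (_ \notin _); lia.
have fj0 i : i \in D -> i != i0 -> exists2 j, f i = Some j & R i j && (j != j0).
  by move=> iD ii0; apply: Rf; rewrite !inE ii0.
exists (fun i => if i == i0 then Some j0 else f i); split=> [i i' iD i'D|i iD].
  case: eqVneq => [->|ii0]; case: eqVneq => [->|i'i0] //.
  - have [j -> /andP[_ jj0]] := fj0 i' i'D i'i0.
    by case=> jj; rewrite jj eqxx in jj0.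
  - have [j -> /andP[_ jj0]] := fj0 i iD ii0.
    by case=> jj; rewrite jj eqxx in jj0.
  by apply: injf; rewrite !inE ?ii0 ?i'i0.
case: eqVneq => [->|ii0]; first by exists j0.
by have [j fj /andP[Rij _]] := fj0 i iD ii0; exists j.
Qed.

Lemma card_sum_set (I J : finType) (S : {set I + J}) :
  #|S| = #|[set i | inl i \in S]| + #|[set j | inr j \in S]|.
Proof. by rewrite -sum1_card big_sumType /= !sum1dep_card. Qed.

(** * Critical decompositions of a graph *)

Section PerfectMatchings.

Variables (T : finType) (e : rel T).
Hypotheses (symE : symmetric e) (irrE : irreflexive e).
Implicit Types (U K A S : {set T}) (P Q : {set {set T}}).

Definition perfectly_matchable K :=
  exists m : T -> T, {in K, forall x, [/\ m x \in K, e x (m x) & m (m x) = x]}.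

Definition factor_critical K := {in K, forall x, perfectly_matchable (K :\ x)}.

Definition touches K a := [exists x in K, e x a].

Lemma perfectly_matchable_even K : perfectly_matchable K -> ~~ odd #|K|.
Proof.
case=> m mK; apply: (@even_card_involution _ K m) => x /mK[mxK exm mm].
by split=> //; apply: contraTneq exm => ->; rewrite irrE.
Qed.

Lemma perfectly_matchable0 : perfectly_matchable set0.
Proof. by exists id => x; rewrite inE. Qed.

Lemma perfectly_matchable2 x y : e x y -> perfectly_matchable [set x; y].
Proof.
move=> exy; have nxy : y != x by apply: contraTneq exy => ->; rewrite irrE.
exists (fun z => if z == x then y else x) => z /set2P[]->.
  by rewrite !eqxx (negPf nxy) set22 exy; split.
by rewrite (negPf nxy) eqxx set21 symE exy; split.
Qed.

Lemma perfectly_matchableU K1 K2 :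
    [disjoint K1 & K2] -> perfectly_matchable K1 -> perfectly_matchable K2 ->
  perfectly_matchable (K1 :|: K2).
Proof.
move=> dis [m1 m1K] [m2 m2K].
exists (fun x => if x \in K1 then m1 x else m2 x) => x.
have [xK1 _|xK1 /=] := boolP (x \in K1).
  by have [mK exm mm] := m1K x xK1; rewrite mK inE mK.
rewrite inE (negPf xK1) /= => xK2; have [mK exm mm] := m2K x xK2.
by rewrite (disjointFl dis mK) inE mK orbT.
Qed.

Lemma perfectly_matchable_bigcup (I : finType) (D : {set I}) (F : I -> {set T}) :
    {in D &, forall i j, i != j -> [disjoint F i & F j]} ->
    {in D, forall i, perfectly_matchable (F i)} ->
  perfectly_matchable (\bigcup_(i in D) F i).
Proof.
have [N] := ubnP #|D|; elim: N D => // N IHN D ltDN dis pmF.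
have [->|[i iD]] := set_0Vmem D; first by rewrite big_set0; apply: perfectly_matchable0.
rewrite (big_setD1 i) //=; apply: perfectly_matchableU; last 2 first.
- exact: pmF.
- apply: IHN => [|j l /setD1P[_ jD] /setD1P[_ lD]|j /setD1P[_ jD]].
  + by rewrite (cardsD1 i) iD in ltDN.
  + exact: dis.
  exact: pmF.
rewrite disjoints_subset; apply/subsetP=> x xF; rewrite inE.
apply/bigcupP=> -[j /setD1P[ji jD] xFj].
by have := disjointFr (dis _ _ jD iD ji) xFj; rewrite xF.
Qed.

(** A Tutte barrier [A] that is extremal in the sense of the Gallai-Edmonds
    theory, for the graph that [e] induces on [U]. Instead of the connected
    components of the rest, [P] collects sets between which there is no edge:
    unlike components, such a family can be modified block by block in an
    extremal argument. *)
Record critical_decomposition U A P : Prop := CriticalDecomposition {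
  cd_sub : A \subset U;
  cd_triv : trivIset P;
  cd_cover : cover P = U :\: A;
  cd_odd : {in P, forall K, odd #|K|};
  cd_critical : {in P, forall K, factor_critical K};
  cd_sep : {in P, forall K, {in K & U, forall x y, e x y -> y \in K :|: A}};
  cd_hall : forall S, S \subset A ->
    #|S| <= #|[set K in P | [exists a in S, touches K a]]|
}.

Lemma factor_criticalU1 K a :
  a \notin K -> factor_critical K -> touches K a -> perfectly_matchable (a |: K).
Proof.
move=> aK critK /existsP[x /andP[xK exa]].
have -> : a |: K = [set x; a] :|: (K :\ x).
  apply/setP=> y; rewrite !inE.
  by case: (eqVneq y x) => [->|_]; rewrite ?xK ?orbT.
apply: perfectly_matchableU; [|exact: perfectly_matchable2|exact: critK].
rewrite -setI_eq0; apply/eqP/setP=> y; rewrite !inE.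
by case: eqVneq => //= yx; case: eqVneq => // ->; rewrite (negPf aK).
Qed.

(** Two systems of Hall conditions are combined: one saturates [A], the other
    the blocks that are not good. Adding |P| - |A| dummy partners, which accept
    exactly the good blocks, turns both into a single Hall condition on the
    side of [P]; as the numbers agree, [A] is used up. A block that is matched
    to a node of [A] is completed by its factor-criticality. *)
Lemma match_up_to_good U A P (good : pred {set T}) :
    critical_decomposition U A P ->
    (forall Z : {set {set T}}, Z \subset P -> {in Z, forall K, ~~ good K} ->
       #|Z| <= #|[set a in A | [exists K in Z, touches K a]]|) ->
  exists Q : {set {set T}},
    [/\ Q \subset P, {in Q, forall K, good K}, #|Q| + #|A| = #|P|
      & perfectly_matchable (U :\: cover Q)].
Proof.
case=> sAU trivP coverP oddP critP sepP hallA hall_bad.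
have leAP : #|A| <= #|P|.
  apply: leq_trans (hallA A (subxx A)) _; apply: subset_leq_card.
  by apply/subsetP=> K; rewrite inE => /andP[].
pose d := #|P| - #|A|.
pose R (K : {set T}) (j : T + 'I_d) :=
  match j with inl a => (a \in A) && touches K a | inr _ => good K end.
have Rcard (S : {set {set T}}) : #|[set j | [exists K in S, R K j]]|
    = #|[set a in A | [exists K in S, touches K a]]|
      + (if [exists K in S, good K] then d else 0).
  rewrite card_sum_set; congr (_ + _).
    apply: eq_card => a; rewrite !inE; apply/existsP/andP.
      by case=> K /and3P[KS -> tK]; split=> //; apply/existsP; exists K; rewrite KS.
    by case=> aA /existsP[K /andP[KS tK]]; exists K; rewrite KS /= aA.
  case: ifPn => [good_S|bad].
    by rewrite -[RHS]card_ord -cardsT; apply: eq_card => i; rewrite !inE.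
  by apply/eqP; rewrite cards_eq0; apply/eqP/setP=> i; rewrite !inE; apply: negbTE.
have [S sSP|f [injf Rf]] := @hall_marriage _ _ P R.
  rewrite Rcard; case: ifPn => [/existsP[K0 /andP[K0S gK0]]|bad]; last first.
    rewrite addn0; apply: hall_bad => // K KS.
    by apply: contraNN bad => gK; apply/existsP; exists K; rewrite KS.
  (* Nodes of [A] without neighbour in [S] see only blocks outside [S]: the
     condition [hallA] for them bounds the number of nodes that [S] misses. *)
  set NA := [set a in A | _].
  have sNA : NA \subset A by apply/subsetP=> a; rewrite inE => /andP[].
  have sB : [set K in P | [exists a in A :\: NA, touches K a]] \subset P :\: S.
    apply/subsetP=> K; rewrite !inE => /andP[-> /existsP[a /andP[aB tKa]]].
    rewrite andbT; apply: contraTN aB => KS; rewrite !inE.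
    have -> : [exists K0 in S, touches K0 a] by apply/existsP; exists K; rewrite KS.
    by rewrite andbT andNb.
  have := leq_trans (hallA (A :\: NA) (subsetDl _ _)) (subset_leq_card sB).
  rewrite !cardsD (setIidPr sNA) (setIidPr sSP).
  have := subset_leq_card sNA; have := subset_leq_card sSP; rewrite /d; lia.
pose Q := [set K in P | if f K is Some (inr _) then true else false].
have sQP : Q \subset P by apply/subsetP=> K; rewrite inE => /andP[].
pose partner K := [set a | f K == Some (inl a)].
have partnerP K : K \in P :\: Q ->
    exists2 a, partner K = [set a] & (a \in A) && touches K a.
  rewrite !inE; case KP: (K \in P); rewrite ?andbF // andbT /=.
  have [[a|i] fK RKa] := Rf K KP; last by rewrite fK.
  by move=> _; exists a => //; apply/setP=> b; rewrite !inE fK; apply/eqP/eqP=> [[]|->].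
have leQ : #|Q| <= d.
  have injQ : {in Q &, injective f} by apply: sub_in2 injf; apply/subsetP.
  rewrite -(card_in_imset injQ).
  have card_inr : #|(Some \o @inr T 'I_d) @: setT| = d.
    by rewrite card_imset ?cardsT ?card_ord // => i j [].
  apply: leq_trans _ (eq_leq card_inr); apply: subset_leq_card; apply/subsetP=> _ /imsetP[K + ->].
  rewrite inE => /andP[_]; case: (f K) => [[//|i]|//] _.
  exact: (imset_f (Some \o @inr T 'I_d)).
have sum_Q : #|Q| + #|P :\: Q| = #|P| by rewrite -(cardsID Q P) (setIidPr sQP).
have fPQ : f @: (P :\: Q) \subset (Some \o @inl T 'I_d) @: A.
  apply/subsetP=> _ /imsetP[K KPQ ->]; have [a pK /andP[aA _]] := partnerP K KPQ.
  have : a \in partner K by rewrite pK set11.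
  by rewrite inE => /eqP->; apply: (imset_f (Some \o @inl T 'I_d)).
have card_fPQ : #|f @: (P :\: Q)| = #|P :\: Q|.
  by apply: card_in_imset; apply: sub_in2 injf; apply/subsetP; apply: subsetDl.
have card_inlA : #|(Some \o @inl T 'I_d) @: A| = #|A|.
  by apply: card_imset => i j [].
have lePQ : #|P :\: Q| <= #|A| by rewrite -card_fPQ -card_inlA subset_leq_card.
have partnerA : \bigcup_(K in P :\: Q) partner K = A.
  apply/setP=> a; apply/bigcupP/idP=> [[K /partnerP[b -> /andP[bA _]] /set1P->]//|aA].
  have : Some (inl a) \in f @: (P :\: Q).
    have /eqP-> : f @: (P :\: Q) == (Some \o @inl T 'I_d) @: A.
      by rewrite eqEcard fPQ card_fPQ card_inlA; rewrite /d in leQ; lia.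
    exact: (imset_f (Some \o @inl T 'I_d)).
  by case/imsetP=> K KPQ fK; exists K => //; rewrite inE -fK.
exists Q; split=> //.
- by move=> K; rewrite inE => /andP[KP]; have [[a|i] -> //] := Rf K KP.
- by rewrite /d in leQ; lia.
have -> : U :\: cover Q = \bigcup_(K in P :\: Q) (partner K :|: K).
  rewrite big_split /= partnerA.
  have cov : \bigcup_(K in P :\: Q) K = cover P :\: cover Q.
    apply/setP=> x; rewrite inE; apply/bigcupP/andP.
      case=> K /setDP[KP KQ] xK; split; last by apply/bigcupP; exists K.
      apply/bigcupP=> -[K' K'Q xK']; have K'P := subsetP sQP _ K'Q.
      have nKK' : K != K' by apply: contraNneq KQ => ->.
      by have := disjointFr (trivIsetP trivP K K' KP K'P nKK') xK; rewrite xK'.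
    case=> xQ /bigcupP[K KP xK]; exists K => //; rewrite inE KP andbT.
    by apply: contraNN xQ => KQ; apply/bigcupP; exists K.
  rewrite cov coverP; apply/setP=> x; rewrite !inE.
  have [xA|//] := boolP (x \in A); rewrite (subsetP sAU) // andbT.
  apply/bigcupP=> -[K /(subsetP sQP) KP xK].
  have : x \in cover P by apply/bigcupP; exists K.
  by rewrite coverP inE xA.
apply: perfectly_matchable_bigcup.
  move=> K K' KPQ K'PQ nKK'.
  have [a pK /andP[aA _]] := partnerP K KPQ.
  have [a' pK' /andP[a'A _]] := partnerP K' K'PQ.
  have KP : K \in P by case/setDP: KPQ.
  have K'P : K' \in P by case/setDP: K'PQ.
  have naa' : a != a'.
    apply: contraNneq nKK' => aa'; apply/eqP/injf => //.
    have : a \in partner K by rewrite pK set11.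
    have : a' \in partner K' by rewrite pK' set11.
    by rewrite !inE aa' => /eqP-> /eqP->.
  have nAP b L : b \in A -> L \in P -> b \notin L.
    move=> bA LP; apply/negP=> bL.
    have : b \in cover P by apply/bigcupP; exists L.
    by rewrite coverP inE bA.
  rewrite pK pK' -setI_eq0; apply/eqP/setP=> x; rewrite !inE.
  have [->|xa] := eqVneq x a.
    by rewrite (negPf naa') (negPf (nAP _ _ aA K'P)).
  have [->|xa'] := eqVneq x a'; first by rewrite (negPf (nAP _ _ a'A KP)).
  by apply/negP=> /= /andP[xK]; rewrite (disjointFr (trivIsetP trivP K K' KP K'P nKK') xK).
move=> K KPQ; have [a -> /andP[aA tKa]] := partnerP K KPQ.
have KP : K \in P by case/setDP: KPQ.
apply: factor_criticalU1 => //; last exact: critP.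
have /subsetP sKU : K \subset U :\: A by rewrite -coverP; apply: bigcup_sup.
by apply/negP=> /sKU; rewrite inE aA.
Qed.

(** The blocks of an odd barrier need not cover the complement of [p.1]: what
    is left over is unconstrained, so that blocks can be removed freely. *)
Definition odd_barrier U (p : {set T} * {set {set T}}) :=
  [&& p.1 \subset U, trivIset p.2, cover p.2 \subset U :\: p.1,
      [forall K in p.2, odd #|K|]
    & [forall K in p.2, forall x in K, forall y in U,
        e x y ==> (y \in K :|: p.1)]].

Lemma odd_barrierP U A P :
  reflect [/\ A \subset U, trivIset P, cover P \subset U :\: A,
              {in P, forall K, odd #|K|}
            & {in P, forall K, {in K & U, forall x y, e x y -> y \in K :|: A}}]
          (odd_barrier U (A, P)).
Proof.
apply: (iffP and5P) => -[sAU trivP sPU oddP sepP]; split=> //.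
- by move=> K KP; apply: (forall_inP oddP).
- move=> K KP x y xK yU exy.
  have /forall_inP/(_ x xK)/forall_inP/(_ y yU) := forall_inP sepP K KP.
  by rewrite exy.
- exact/forall_inP.
apply/forall_inP=> K KP; apply/forall_inP=> x xK; apply/forall_inP=> y yU.
by apply/implyP; apply: sepP.
Qed.

(** The barrier is chosen with |P| - |A| maximal and, among these, with |A|
    maximal. *)
Lemma odd_barrier_max U : exists A P,
  odd_barrier U (A, P) /\
  (forall A' P', odd_barrier U (A', P') ->
     #|P'| + #|A| <= #|P| + #|A'|
     /\ (#|P| + #|A'| <= #|P'| + #|A| -> #|A'| <= #|A|)).
Proof.
(* As |A| <= t, the weight orders by |P| - |A| first and by |A| second; the
   truncated differences t - |A| are exact. *)
pose t := #|T|; pose wt (p : {set T} * {set {set T}}) :=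
  t.+1 * (#|p.2| + (t - #|p.1|)) + #|p.1|.
have ob0 : odd_barrier U (set0, set0).
  apply/odd_barrierP; split; rewrite ?sub0set //.
  - by apply/trivIsetP=> K; rewrite inE.
  - by rewrite /cover big_set0 sub0set.
  - by move=> K; rewrite inE.
  by move=> K; rewrite inE.
case: (arg_maxnP wt ob0) => -[A P] obP maxP; exists A, P; split=> // A' P' obP'.
have := maxP (A', P') obP'; rewrite /wt /=.
have le_t (B : {set T}) : #|B| <= t by apply: max_card.
have := le_t A; have := le_t A'; move: #|A| #|A'| #|P| #|P'| => a a' p p' leA' leA le_wt.
by split; nia.
Qed.

Lemma odd_cover P :
  trivIset P -> {in P, forall K, odd #|K|} -> odd #|cover P| = odd #|P|.
Proof.
move=> /eqP <- oddP; rewrite -sum1_card !(big_morph odd oddD (erefl _)).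
by apply: eq_bigr => K /oddP->.
Qed.

(** Take the extremal odd barrier of [odd_barrier_max]. A node outside [A] and
    all blocks could be moved to [A], or the whole rest be made a block. If a
    block [C] without a node [c] has no perfect matching, then by induction it
    has a barrier with excess at least 2, by parity, and inserting this barrier
    together with [c] enlarges [A] without loss of excess. If Hall's condition
    fails for some [S], deleting [S] from [A] and its neighbouring blocks from
    [P] increases the excess. *)
Theorem critical_decomposition_exists U : exists A P, critical_decomposition U A P.
Proof.
have [N] := ubnP #|U|; elim: N U => // N IHN U ltUN.
have [A [P [/odd_barrierP[sAU trivP sPU oddP sepP] maxAP]]] := odd_barrier_max U.
have P0 : set0 \notin P by apply/negP=> /oddP; rewrite cards0.
have sKU K : K \in P -> {subset K <= U :\: A}.
  by move=> KP x xK; apply: (subsetP sPU); apply/bigcupP; exists K.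
have coverP : cover P = U :\: A.
  apply/eqP; rewrite eqEsubset sPU /= -setD_eq0; set W := _ :\: _.
  apply: contraT => /set0Pn[c cW].
  have addW (B : {set T}) (L : {set T}) : B \subset W -> L = W :\: B -> odd #|L| ->
      odd_barrier U (A :|: B, L |: P) /\ #|L |: P| = #|P|.+1.
    move=> sBW defL oddL.
    have sLW : L \subset W by rewrite defL subsetDl.
    have WP x K : x \in W -> K \in P -> x \notin K.
      rewrite !inE => /andP[+ _] KP; apply: contra => xK.
      by apply/bigcupP; exists K.
    have dLK : {in P, forall K, [disjoint L & K]}.
      move=> K KP; rewrite -setI_eq0; apply/eqP/setP=> x; rewrite !inE.
      by apply/negP=> /andP[/(subsetP sLW) xW]; apply/negP/WP.
    have [trivLP LP] := trivIsetU1 dLK trivP P0.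
    split; last by rewrite cardsU1 LP.
    have WU x : x \in W -> (x \in U) && (x \notin A).
      by rewrite !inE => /and3P[_ -> ->].
    apply/odd_barrierP; split=> //.
    - rewrite subUset sAU; apply/subsetP=> x /(subsetP sBW) /WU.
      by case/andP.
    - apply/subsetP=> x /bigcupP[K /setU1P[->|KP] xK].
        have /WU/andP[xU xA] := subsetP sLW x xK.
        by move: xK; rewrite defL => /setDP[_ xB]; rewrite !inE xU (negPf xA) (negPf xB).
      have := sKU K KP x xK; rewrite !inE => /andP[xA ->].
      rewrite (negPf xA) andbT /=; apply/negP=> /(subsetP sBW) xW.
      by have := WP x K xW KP; rewrite xK.
    - by move=> K /setU1P[->|/oddP].
    move=> K /setU1P[->|KP] x y xK yU exy; last first.
      by have := sepP K KP x y xK yU exy; rewrite !inE => /orP[]->; rewrite ?orbT.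
    have xW := subsetP sLW x xK.
    rewrite defL !inE yU andbT; case yA: (y \in A) => /=; first by rewrite !orbT.
    case yB: (y \in B) => /=; rewrite ?orbF // andbT.
    apply/bigcupP=> -[K' K'P yK'].
    have /andP[xU xA] := WU x xW; rewrite symE in exy.
    have := sepP K' K'P y x yK' xU exy; rewrite inE (negPf xA) orbF.
    by apply/negP/WP.
  have cA : c \notin A by move: cW; rewrite !inE => /and3P[_ ->].
  have [oddW|evenW] := boolP (odd #|W|).
    have [|||ob cP] := addW set0 W; rewrite ?sub0set ?setD0 //.
    have [+ _] := maxAP _ _ ob; rewrite cP setU0; lia.
  have [|//||ob cP] := addW [set c] (W :\ c); first by rewrite sub1set.
    by move: evenW; rewrite (cardsD1 c) cW /= negbK.
  by have [_] := maxAP _ _ ob; rewrite cP setUC cardsU1 cA; lia.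
exists A, P; split=> //.
- move=> C CP c cC.
  have sCU x : x \in C -> x \in U by move/(sKU C CP); rewrite inE => /andP[].
  have cardC := cardsD1 c C; rewrite cC in cardC.
  have [|A' [P' dec]] := IHN (C :\ c).
    by have := subset_leq_card (introT subsetP sCU); lia.
  have [Q [sQP' _ cardQ pmQ]] : exists Q : {set {set T}},
      [/\ Q \subset P', {in Q, forall K, true}, #|Q| + #|A'| = #|P'|
        & perfectly_matchable ((C :\ c) :\: cover Q)].
    apply: match_up_to_good dec _ => Z _ bad.
    by have [->|[K /bad]] := set_0Vmem Z; rewrite ?cards0.
  have [Q0|Qn0] := eqVneq #|Q| 0.
    by rewrite (cards0_eq Q0) /cover big_set0 setD0 in pmQ.
  have Q2 : 2 <= #|Q|.
    have trivQ := trivIsetS sQP' (cd_triv dec).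
    have oddQ : odd #|cover Q| = odd #|Q|.
      by apply: odd_cover => // K /(subsetP sQP')/(cd_odd dec).
    have sQC : cover Q \subset C :\ c.
      apply/subsetP=> x /bigcupP[K /(subsetP sQP') KP' xK].
      have : x \in cover P' by apply/bigcupP; exists K.
      by rewrite (cd_cover dec) => /setDP[].
    have := perfectly_matchable_even pmQ.
    rewrite cardsD (setIidPr sQC) oddB ?subset_leq_card // oddQ.
    have := oddP C CP; rewrite cardC /= => /negPf->.
    by case: #|Q| Qn0 => [|[]].
  have cA : c \notin A by have := sKU C CP c cC; rewrite inE => /andP[].
  have sP'C K x : K \in P' -> x \in K -> [/\ x \in C, x != c & x \notin A'].
    move=> KP' xK; have : x \in cover P' by apply/bigcupP; exists K.
    by rewrite (cd_cover dec) !inE => /and3P[].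
  have sA'C x : x \in A' -> (x \in C) && (x != c).
    by move/(subsetP (cd_sub dec)); rewrite !inE andbC.
  have notC K x : K \in P -> K != C -> x \in K -> x \notin C.
    by move=> KP nKC xK; rewrite (disjointFr (trivIsetP trivP K C KP CP nKC) xK).
  have [|_] := maxAP (c |: (A :|: A')) ((P :\ C) :|: P').
    apply/odd_barrierP; split.
    - rewrite !subUset sub1set sCU // sAU; apply/subsetP=> x /sA'C/andP[xC _].
      exact: sCU.
    - apply: trivIsetU; rewrite ?(trivIsetD _ trivP) ?(cd_triv dec) //.
      rewrite -setI_eq0; apply/eqP/setP=> x; rewrite !inE; apply/negP.
      case/andP=> /bigcupP[K /setD1P[nKC KP] xK] /bigcupP[K' K'P' xK'].
      by have [xC _ _] := sP'C K' x K'P' xK'; have := notC K x KP nKC xK; rewrite xC.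
    - apply/subsetP=> x /bigcupP[K /setUP[/setD1P[nKC KP]|KP'] xK].
        have := sKU K KP x xK; rewrite !inE => /andP[/negPf-> ->] /=.
        have xC := notC K x KP nKC xK; rewrite andbT negb_or.
        apply/andP; split; first by apply: contraNneq xC => ->.
        by apply: contraNN xC => /sA'C/andP[].
      have [xC xc xA'] := sP'C K x KP' xK.
      have := sKU C CP x xC; rewrite !inE => /andP[xA ->].
      by rewrite (negPf xc) (negPf xA) (negPf xA').
    - by move=> K /setUP[/setD1P[_ /oddP]|/(cd_odd dec)].
    move=> K /setUP[/setD1P[_ KP]|KP'] x y xK yU exy.
      by have := sepP K KP x y xK yU exy; rewrite !inE => /orP[]->; rewrite ?orbT.
    have [xC _ _] := sP'C K x KP' xK.
    have := sepP C CP x y xC yU exy; rewrite !inE => /orP[yC|->]; last by rewrite !orbT.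
    case: (eqVneq y c) => [|yc] /=; first by rewrite orbT.
    have yCc : y \in C :\ c by rewrite !inE yc.
    have := cd_sep dec KP' xK yCc exy.
    by rewrite inE => /orP[]->; rewrite ?orbT.
  have disP : #|P :\ C :|: P'| = #|P :\ C| + #|P'|.
    rewrite -cardsUI; have -> : (P :\ C) :&: P' = set0; last by rewrite cards0 addn0.
    apply/setP=> K; rewrite !inE; apply/negP=> /andP[/andP[nKC KP] KP'].
    have := P0; have [K0|[x xK]] := set_0Vmem K; first by rewrite -K0 KP.
    by have [xC _ _] := sP'C K x KP' xK; have := notC K x KP nKC xK; rewrite xC.
  have cardA : #|A|.+1 <= #|c |: (A :|: A')| <= #|A|.+1 + #|A'|.
    have -> : #|A|.+1 = #|c |: A| by rewrite cardsU1 cA.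
    rewrite setUA subset_leq_card ?subsetUl //=.
    by apply: leq_card_setU.
  have := cardsD1 C P; rewrite CP disP; lia.
move=> S sSA; rewrite leqNgt; apply/negP=> ltNS.
set NS := [set K in P | _] in ltNS.
have [|le1 _] := maxAP (A :\: S) (P :\: NS).
  apply/odd_barrierP; split.
  - by apply: subset_trans sAU; apply: subsetDl.
  - exact: trivIsetD.
  - apply/subsetP=> x /bigcupP[K /setDP[KP _] xK].
    by have := sKU K KP x xK; rewrite !inE negb_and => /andP[-> ->]; rewrite orbT.
  - by move=> K /setDP[/oddP].
  move=> K /setDP[KP KNS] x y xK yU exy.
  have := sepP K KP x y xK yU exy; rewrite !inE => /orP[->//|yA]; rewrite yA andbT.
  apply/orP; right; apply: contraNN KNS => yS; rewrite inE KP.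
  by apply/existsP; exists y; rewrite yS; apply/existsP; exists x; rewrite xK.
have sNSP : NS \subset P by apply/subsetP=> K; rewrite inE => /andP[].
move: le1; rewrite !cardsD (setIidPr sSA) (setIidPr sNSP).
have := subset_leq_card sSA; have := subset_leq_card sNSP; lia.
Qed.

(** Each member of [Z] sends weight at least 1 to its neighbours in [A], and no
    node of [A] receives more than 1. *)
Lemma fractional_hall U A P (Z : {set {set T}}) (w : T -> T -> rat) :
    critical_decomposition U A P -> Z \subset P ->
    (forall x y, 0 <= w x y)%R -> (forall x y, w x y = w y x) ->
    (forall x y, ~~ e x y -> w x y = 0%R) ->
    {in U, forall x, \sum_(y in U) w x y <= 1}%R ->
    {in Z, forall K, 1 <= \sum_(x in K) \sum_(y in U :\: K) w x y}%R ->
  #|Z| <= #|[set a in A | [exists K in Z, touches K a]]|.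
Proof.
move=> dec sZP w0 wC wE w1 wZ; set NA := [set a in A | _].
have sNA : NA \subset U.
  by apply: subset_trans (cd_sub dec); apply/subsetP=> a; rewrite inE => /andP[].
have sZU : cover Z \subset U.
  apply/subsetP=> x /bigcupP[K /(subsetP sZP) KP xK].
  have : x \in cover P by apply/bigcupP; exists K.
  by rewrite (cd_cover dec) => /setDP[].
have out K x : K \in Z -> x \in K ->
    (\sum_(y in U :\: K) w x y <= \sum_(y in NA) w x y)%R.
  move=> KZ xK; have xZ : x \in cover Z by apply/bigcupP; exists K.
  rewrite (big_setID NA) /= [X in (_ + X)%R]big1 ?addr0; last first.
    move=> y /setDP[/setDP[yU yK] yNA]; apply: wE; apply: contra yNA => exy.
    have := cd_sep dec (subsetP sZP K KZ) xK yU exy; rewrite !inE (negPf yK) /= => ->.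
    by apply/existsP; exists K; rewrite KZ; apply/existsP; exists x; rewrite xK.
  rewrite [X in (_ <= X)%R](big_setID (U :\: K)) /= setIC lerDl.
  by apply: sumr_ge0.
suff: (#|Z|%:R <= #|NA|%:R :> rat)%R by rewrite ler_nat.
rewrite -!sumr_const; apply: (le_trans (ler_sum _ wZ)).
apply: (@le_trans _ _ (\sum_(K in Z) \sum_(x in K) \sum_(y in NA) w x y)%R).
  by apply: ler_sum => K KZ; apply: ler_sum => x; apply: out.
rewrite -(big_trivIset _ (trivIsetS sZP (cd_triv dec))) exchange_big /=.
apply: ler_sum => y yNA; apply: le_trans (w1 y (subsetP sNA y yNA)).
rewrite [X in (_ <= X)%R](big_setID (cover Z)) /= (setIidPr sZU).
rewrite (eq_bigr (w y)) => [|x _]; last exact: wC.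
by rewrite lerDl sumr_ge0.
Qed.

End PerfectMatchings.

(** * The gadget graph of a degree-reduced subgraph *)

Section Gadget.

Variables (V : finType) (h : rel V) (c : V -> nat).
Hypotheses (symh : symmetric h) (irrh : irreflexive h).
Implicit Types (u v : V).

Definition deg v := #|[set u | h v u]|.

Hypothesis c_le : forall v, c v <= deg v.

Notation node := (V * V + V * 'I_#|V|)%type.
Implicit Types (x y : node) (K L : {set node}).

(** The port at [u] of the edge uv is [inl (u, v)], and the cores of [v] are the
    nodes [inr (v, i)] with [i < c v]. Nodes outside [gadget] may be related as
    well; only the graph induced on [gadget] matters. *)
Definition gadget_rel : rel node := fun x y =>
  match x, y with
  | inl p, inl p' => h p.1 p.2 && (p' == (p.2, p.1))
  | inl p, inr s | inr s, inl p => p.1 == s.1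
  | inr _, inr _ => false
  end.

Definition gadget : {set node} :=
  [set x : node | match x with inl p => h p.1 p.2 | inr s => s.2 < c s.1 end].

Definition ports K v := #|[set u | inl (v, u) \in K]|.
Definition cores K v := #|[set i | inr (v, i) \in K]|.

Lemma gadget_rel_sym : symmetric gadget_rel.
Proof.
move=> [[u v]|s] [[u' v']|s'] //=.
apply/idP/idP=> /andP[+ /eqP[]] => + -> ->; rewrite symh => ->; exact: eqxx.
Qed.

Lemma gadget_rel_irr : irreflexive gadget_rel.
Proof. by case=> [[u v]|s] //=; apply/andP=> -[huv /eqP[uv _]]; rewrite uv irrh in huv.
Qed.

Lemma ports_gadget v : ports gadget v = deg v.
Proof. by apply: eq_card => u; rewrite !inE. Qed.

Lemma cores_gadget v : cores gadget v = c v.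
Proof.
have le_cV : c v <= #|V| := leq_trans (c_le v) (max_card _).
rewrite /cores -sum1dep_card.
under eq_bigl => i do rewrite inE /=.
by rewrite (big_ord_narrow le_cV) sum1_card card_ord.
Qed.

(** In a matching each core at [v] takes up one port at [v]; every other port
    is matched to the opposite port of its edge. *)
Lemma matched_ports L (m : node -> node) v :
    L \subset gadget ->
    {in L, forall x, [/\ m x \in L, gadget_rel x (m x) & m (m x) = x]} ->
  #|[set u | (inl (v, u) \in L) && (m (inl (v, u)) == inl (u, v))]| + cores L v
    = ports L v.
Proof.
move=> sLG mL; pose F := [set u | (inl (v, u) \in L) && (m (inl (v, u)) == inl (u, v))].
have sF : F \subset [set u | inl (v, u) \in L].
  by apply/subsetP=> u; rewrite !inE => /andP[].
rewrite -/F /ports -(cardsID F [set u | _]) (setIidPr sF); congr addn.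
pose g i := if m (inr (v, i)) is inl p then p.2 else v.
have gP i : inr (v, i) \in L -> m (inr (v, i)) = inl (v, g i).
  rewrite /g => /mL[_]; case: (m _) => [[u u'] /= /eqP->|] //.
rewrite /cores -(@card_in_imset _ _ g) => [|i j]; last first.
  rewrite !inE => iL jL gij.
  have [[_ _ mi] [_ _ mj]] := (mL _ iL, mL _ jL).
  by move: mi; rewrite (gP i iL) gij -(gP j jL) mj => -[].
apply: eq_card => u; rewrite !inE; apply/imsetP/andP => [[i]|[+ vuL]].
  rewrite inE => iL ->; have [mL1 _ mi] := mL _ iL.
  by rewrite -(gP i iL) mL1 mi.
rewrite vuL /= => nF; have [] := mL _ vuL.
case E: (m _) nF => [p|[v' i]] nF mvL /=.
  by case/andP=> _ pE; case/negP: nF.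
move/eqP=> vv' mi; rewrite -{}vv' in mvL mi.
by exists i; rewrite ?inE // /g mi.
Qed.

Lemma sum_slice (A B : finType) (R : nmodType) (S : {set A * B}) (f : A -> R) :
  (\sum_(s in S) f s.1 = \sum_a f a *+ #|[set b | (a, b) \in S]|)%R.
Proof.
rewrite [LHS](eq_bigl (fun s => xpredT s.1 && ((s.1, s.2) \in S))) => [|[a b]] //.
rewrite -(pair_big_dep xpredT (fun a b => (a, b) \in S) (fun a b => f a)) /=.
by apply: eq_bigr => a _; rewrite -sumr_const; apply: eq_bigl => b; rewrite inE.
Qed.

Lemma card_slices (A B : finType) (S : {set A * B}) :
  #|S| = \sum_a #|[set b | (a, b) \in S]|.
Proof.
rewrite -sum1_card (sum_slice S (fun=> 1)).
by apply: eq_bigr => a _; rewrite -[LHS]/(1 *+ _)%R natn.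
Qed.

Lemma sum_pick (A B : finType) (S : {set A * B}) (a : A) (r : rat) :
  (\sum_(s in S) (if a == s.1 then r else 0) = r *+ #|[set b | (a, b) \in S]|)%R.
Proof.
rewrite (sum_slice S (fun a' => if a == a' then r else 0)%R) (bigD1 a) //= eqxx.
by rewrite big1 ?addr0 // => a' /negPf; rewrite eq_sym => ->; rewrite mul0rn.
Qed.

(** * Weights on the gadget graph *)

Variable theta : rat.

Definition weight x y : rat :=
  match x, y with
  | inl p, inl p' => if h p.1 p.2 && (p' == (p.2, p.1)) then theta else 0
  | inl p, inr s | inr s, inl p => if p.1 == s.1 then (deg p.1)%:R^-1 else 0
  | inr _, inr _ => 0
  end%R.

Lemma weight_sym x y : weight x y = weight y x.
Proof.
case: x y => [[u v]|s] [[u' v']|s'] //=; congr (if _ then _ else _).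
by apply/andP/andP=> -[+ /eqP[-> ->]]; rewrite symh.
Qed.

Lemma weight_ge0 : (0 <= theta)%R -> forall x y, (0 <= weight x y)%R.
Proof. by move=> t0 [p|s] [p'|s'] //=; case: ifP => // _; rewrite invr_ge0 ler0n. Qed.

Lemma weight_out x y : ~~ gadget_rel x y -> weight x y = 0%R.
Proof. by case: x y => [p|s] [p'|s'] //= /negPf->. Qed.

Lemma weight_port p L : h p.1 p.2 ->
  (\sum_(y in L) weight (inl p) y
     = (if inl (p.2, p.1) \in L then theta else 0) + (deg p.1)%:R^-1 *+ cores L p.1)%R.
Proof.
move=> hp; rewrite big_sumType /= hp /=; congr (_ + _)%R.
  rewrite -big_mkcondr /=; case: ifPn => pL.
    rewrite (big_pred1 (p.2, p.1)) // => p'; rewrite andbC /=.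
    by case: eqVneq => // ->.
  by rewrite big1 // => p' /andP[+ /eqP pE]; rewrite pE (negPf pL).
have := sum_pick [set s | inr s \in L] p.1 (deg p.1)%:R^-1%R.
rewrite (eq_bigl (fun s => inr s \in L)) => [->|s]; last by rewrite inE.
by congr (_ *+ _)%R; apply: eq_card => i; rewrite !inE.
Qed.

Lemma weight_core s L :
  (\sum_(y in L) weight (inr s) y = (deg s.1)%:R^-1 *+ ports L s.1)%R.
Proof.
rewrite big_sumType /= [X in (_ + X)%R]big1 // addr0.
have := sum_pick [set p | inl p \in L] s.1 (deg s.1)%:R^-1%R.
rewrite (eq_bigl (fun p => inl p \in L)) => [E|p]; last by rewrite inE.
rewrite [RHS](_ : _ = (deg s.1)%:R^-1 *+ #|[set b | (s.1, b) \in [set p | inl p \in L]]|)%R.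
  rewrite -E; apply: eq_bigr => p _; rewrite [in RHS]eq_sym.
  by case: eqP => // ->.
by congr (_ *+ _)%R; apply: eq_card => i; rewrite !inE.
Qed.

Definition open_ports K := [set p : V * V | (inl p \in K) && (inl (p.2, p.1) \notin K)].

Lemma card_ports_cores K : #|K| = \sum_v (ports K v + cores K v).
Proof.
rewrite card_sum_set !card_slices big_split; congr (_ + _); apply: eq_bigr => v _;
by apply: eq_card => i; rewrite !inE.
Qed.

(** The ports whose partners also lie in [K] come in pairs. *)
Lemma odd_open_ports K : K \subset gadget -> odd #|open_ports K| = odd (\sum_v ports K v).
Proof.
move=> sKG; pose S := [set p | inl p \in K].
have -> : \sum_v ports K v = #|S|.
  by rewrite card_slices; apply: eq_bigr => v _; apply: eq_card => u; rewrite !inE.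
pose sw (p : V * V) := (p.2, p.1).
rewrite -(cardsID (open_ports K) S) oddD.
have -> : S :&: open_ports K = open_ports K.
  by apply/setIidPr/subsetP=> p; rewrite !inE => /andP[].
rewrite (_ : odd #|S :\: open_ports K| = false) ?addbF //.
apply/negbTE/(even_card_involution (m := sw)) => -[u v]; rewrite !inE /=.
case/andP=> + uvK; rewrite uvK /= negbK => vuK; rewrite vuK; split=> //.
apply/eqP=> -[uv _]; have := subsetP sKG _ uvK.
by rewrite inE /= uv irrh.
Qed.

Lemma ports_le K v : K \subset gadget -> ports K v <= deg v.
Proof.
move=> sKG; apply: subset_leq_card; apply/subsetP=> u; rewrite !inE => uK.
by have := subsetP sKG _ uK; rewrite inE.
Qed.

Lemma cores_le K v : K \subset gadget -> cores K v <= c v.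
Proof.
move=> sKG; rewrite -cores_gadget; apply: subset_leq_card; apply/subsetP=> i; rewrite !inE => iK.
by have := subsetP sKG _ iK; rewrite inE.
Qed.

Lemma portsD K v : K \subset gadget -> ports (gadget :\: K) v = deg v - ports K v.
Proof.
move=> sKG; rewrite -ports_gadget /ports -(cardsID [set u | inl (v, u) \in K] [set u | _ \in gadget]).
rewrite (setIidPr _); last by apply/subsetP=> u; rewrite !inE => /(subsetP sKG); rewrite inE.
by rewrite addKn; apply: eq_card => u; rewrite !inE.
Qed.

Lemma coresD K v : K \subset gadget -> cores (gadget :\: K) v = c v - cores K v.
Proof.
move=> sKG; rewrite -cores_gadget /cores -(cardsID [set u | inr (v, u) \in K] [set u | _ \in gadget]).
rewrite (setIidPr _); last by apply/subsetP=> u; rewrite !inE => /(subsetP sKG); rewrite inE.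
by rewrite addKn; apply: eq_card => u; rewrite !inE.
Qed.

(** Core-port edges leave [K] at [v] either from a port in [K] to a core outside
    or from a core in [K] to a port outside. *)
Lemma boundary_weight K : K \subset gadget ->
  (\sum_(x in K) \sum_(y in gadget :\: K) weight x y = theta *+ #|open_ports K|
   + \sum_v (ports K v * (c v - cores K v) + cores K v * (deg v - ports K v))%:R / (deg v)%:R)%R.
Proof.
move=> sKG; rewrite big_sumType /=.
have hK p : inl p \in K -> h p.1 p.2 by move/(subsetP sKG); rewrite inE.
rewrite (eq_bigr _ (fun p pK => weight_port _ (hK p pK))).
rewrite (eq_bigr _ (fun s _ => weight_core s _)).
rewrite big_split -addrA /=; congr (_ + _)%R.
  rewrite -big_mkcondr -sumr_const; apply: eq_bigl => p; rewrite !inE /=.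
  by have [/hK|//] := boolP (inl p \in K); rewrite symh => ->; rewrite andbT.
have := sum_slice [set p | inl p \in K] (fun v => (deg v)%:R^-1 *+ cores (gadget :\: K) v : rat)%R.
rewrite (eq_bigl (fun p => inl p \in K)) => [->|p]; last by rewrite inE.
have := sum_slice [set s | inr s \in K] (fun v => (deg v)%:R^-1 *+ ports (gadget :\: K) v : rat)%R.
rewrite (eq_bigl (fun s => inr s \in K)) => [->|p]; last by rewrite inE.
rewrite -big_split /=; apply: eq_bigr => v _; rewrite portsD // coresD //.
have -> : #|[set b | (v, b) \in [set p | inl p \in K]]| = ports K v.
  by apply: eq_card => u; rewrite !inE.
have -> : #|[set b | (v, b) \in [set s | inr s \in K]]| = cores K v.
  by apply: eq_card => u; rewrite !inE.
by rewrite -!mulrnA -mulrnDr mulr_natl mulnC [X in (_ + X)%N]mulnC.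
Qed.

(** * Light blocks *)

Lemma extract_subgraph L :
    L \subset gadget -> perfectly_matchable gadget_rel L ->
  exists F : rel V, [/\ symmetric F, subrel F h
    & forall v, #|[set u | F v u]| + cores L v = ports L v].
Proof.
move=> sLG [m mL]; exists (fun v u => (inl (v, u) \in L) && (m (inl (v, u)) == inl (u, v))).
split=> [v u|v u|v]; last exact: matched_ports.
  by apply/andP/andP=> -[/mL[+ _] + /eqP mE]; rewrite mE => -> ->.
by case/andP=> /(subsetP sLG); rewrite inE.
Qed.

(** The number of ports at [v] on the other side of the boundary of [K] than
    the cores of [v], when all these cores are on the same side. *)
Definition missing K v := if cores K v == 0 then ports K v else deg v - ports K v.

Variables (q k : nat).
Hypotheses (k_gt0 : 0 < k) (ltkq : k < q).
Hypothesis cE : forall v, q * c v = (q - k) * deg v.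
Hypothesis thetaE : theta = (k%:R / q%:R)%R.

Lemma c_div_deg v : 0 < deg v -> ((c v)%:R / (deg v)%:R = 1 - theta)%R.
Proof.
move=> d_gt0; have d_neq0 : ((deg v)%:R != 0 :> rat)%R by rewrite pnatr_eq0 -lt0n.
have q_neq0 : (q%:R != 0 :> rat)%R by rewrite pnatr_eq0; lia.
have E : (q%:R * (c v)%:R = (q%:R - k%:R) * (deg v)%:R :> rat)%R.
  by rewrite -natrB ?(ltnW ltkq) // -!natrM cE.
rewrite thetaE; apply: (mulfI q_neq0); rewrite mulrA E; field.
by rewrite q_neq0.
Qed.

Lemma weight_total x : x \in gadget -> (\sum_(y in gadget) weight x y = 1)%R.
Proof.
rewrite inE; case: x => [[u v] huv|[v i] ltic].
  rewrite weight_port // inE /= symh huv cores_gadget -[(_ *+ c u)%R]mulr_natl c_div_deg.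
    by rewrite addrC subrK.
  by apply/card_gt0P; exists v; rewrite inE.
rewrite /= in ltic; rewrite weight_core ports_gadget -[(_ *+ _)%R]mulr_natl mulfV // pnatr_eq0.
by have := c_le v; rewrite /=; lia.
Qed.

(** If [v] has a core in [K] and another one outside, then each port at [v] has
    an edge to a core on the other side, and these edges alone weigh at least
    deg(v) / deg(v) = 1. Otherwise every port counted by [missing] contributes
    c(v) / deg(v) = 1 - theta. *)
Lemma boundary_dichotomy K (W := (\sum_(x in K) \sum_(y in gadget :\: K) weight x y)%R) :
    K \subset gadget ->
  (1 <= W)%R \/ (forall v, cores K v = 0 \/ cores K v = c v) /\
    W = (theta *+ #|open_ports K| + (1 - theta) *+ \sum_v missing K v)%R.
Proof.
move=> sKG; rewrite /W boundary_weight //.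
have theta_ge0 : (0 <= theta)%R by rewrite thetaE divr_ge0 ?ler0n.
have [/existsP[v /andP[b_gt0 b_ltc]]|/existsPn nmixed] :=
    boolP [exists v, (0 < cores K v) && (cores K v < c v)].
  left; rewrite (bigD1 v) //= addrCA.
  apply: (@le_trans _ _ (1 + 0)%R); first by rewrite addr0.
  apply: lerD; last first.
    apply: addr_ge0; first by rewrite mulrn_wge0.
    by apply: sumr_ge0 => u _; rewrite divr_ge0 ?ler0n.
  have d_gt0 : 0 < deg v by have := c_le v; lia.
  rewrite ler_pdivlMr ?ltr0n // mul1r ler_nat.
  by have := ports_le v sKG; nia.
right; split=> [v|].
  have := nmixed v; have := cores_le v sKG.
  case: (cores K v) => [|b] leb /=; first by move=> _; left.
  by rewrite -leqNgt => geb; right; apply/eqP; rewrite eqn_leq leb.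
congr (_ + _)%R; rewrite -sumrMnr; apply: eq_bigr => v _.
have [d0|d_gt0] := posnP (deg v).
  have := ports_le v sKG; rewrite /missing d0 leqn0 => /eqP->.
  by rewrite if_same invr0 mulr0 mulr0n.
rewrite -(c_div_deg d_gt0) /missing; have := cores_le v sKG; have := nmixed v.
case: eqVneq => [-> _ _|b0 nlt leb].
  by rewrite subn0 mul0n addn0 natrM -[RHS]mulr_natl mulrA.
have -> : cores K v = c v by lia.
by rewrite subnn muln0 add0n natrM -[RHS]mulr_natr mulrAC.
Qed.

Lemma boundary_ge1 l m : q <= k * l + (q - k) * m ->
  (1 <= theta *+ l + (1 - theta) *+ m :> rat)%R.
Proof.
move=> le_q; have q_gt0 : (0 < q%:R :> rat)%R by rewrite ltr0n; lia.
have -> : (1 - theta = (q - k)%:R / q%:R)%R.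
  by rewrite thetaE natrB ?(ltnW ltkq) // mulrBl divff ?gt_eqF.
rewrite thetaE -[(_ / _ *+ l)%R]mulr_natr -[(_ / _ *+ m)%R]mulr_natr.
rewrite !(mulrAC _ (_^-1)%R) -mulrDl ler_pdivlMr // mul1r.
by rewrite -!natrM -natrD ler_nat.
Qed.

Lemma odd_sum (I : finType) (f g : I -> nat) :
  (forall i, odd (f i) = odd (g i)) -> odd (\sum_i f i) = odd (\sum_i g i).
Proof.
by move=> fg; rewrite !(big_morph odd oddD (erefl _)); apply: eq_bigr => i _.
Qed.

Lemma odd_open_odd_block K :
    (forall v, ~~ odd (c v)) -> (forall v, cores K v = 0 \/ cores K v = c v) ->
    K \subset gadget -> odd #|K| -> odd #|open_ports K|.
Proof.
move=> c_even cores01 sKG; rewrite card_ports_cores odd_open_ports //.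
apply: etrans; apply: odd_sum => v; rewrite oddD.
by case: (cores01 v) => ->; rewrite ?(negPf (c_even v)) addbF.
Qed.

(** Since some port of [K] is open, a single missing port already brings the
    weight up to theta + (1 - theta). *)
Lemma odd_block K : (forall v, ~~ odd (c v)) -> K \subset gadget -> odd #|K| ->
  (1 <= \sum_(x in K) \sum_(y in gadget :\: K) weight x y)%R \/
  (forall v, cores K v = 0 \/ cores K v = c v) /\ forall v, missing K v = 0.
Proof.
move=> c_even sKG oddK; have [|[cores01 ->]] := boundary_dichotomy sKG; first by left.
have oddl := odd_open_odd_block c_even cores01 sKG oddK.
have l_gt0 : 0 < #|open_ports K| by rewrite lt0n; apply: contraTneq oddl => ->.
have [/eqP|m_gt0] := posnP (\sum_v missing K v).
  by rewrite sum_nat_eq0 => /forallP m0; right; split=> // v; exact/eqP/m0.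
left; apply: boundary_ge1.
have := leq_mul (leqnn k) l_gt0; have := leq_mul (leqnn (q - k)) m_gt0; lia.
Qed.

(** Since deg(v) and c(v) have the same parity, the size of [K] has the parity
    of the number m of missing ports, so m is odd. If m >= 3, the weight is at
    least 3(1 - theta) >= 1; if m = 1, one open port brings it up to 1. *)
Lemma even_block K :
    (forall v, odd (c v) = odd (deg v)) -> 3 * k <= 2 * q -> K \subset gadget -> odd #|K| ->
  (1 <= \sum_(x in K) \sum_(y in gadget :\: K) weight x y)%R \/
  [/\ forall v, cores K v = 0 \/ cores K v = c v, \sum_v missing K v = 1 & open_ports K = set0].
Proof.
move=> c_par le32 sKG oddK.
have [|[cores01 ->]] := boundary_dichotomy sKG; first by left.
have : odd (\sum_v missing K v).
  move: oddK; rewrite card_ports_cores; apply: etrans; apply: odd_sum => v; rewrite /missing oddD.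
  case: (cores01 v) => ->; first by rewrite addbF.
  case: eqVneq => [->|c0]; first by rewrite addbF.
  by rewrite oddB ?ports_le // c_par addbC.
case m1: (\sum_v missing K v) => [|[|[|m]]] // _.
  have [l0|l_gt0] := posnP #|open_ports K|; first by right; split=> //; apply: cards0_eq.
  by left; apply: boundary_ge1; have := leq_mul (leqnn k) l_gt0; lia.
by left; apply: boundary_ge1; have := leq_mul (leqnn (q - k)) (isT : 3 <= m.+3); lia.
Qed.

(** * From matchings to divisible subgraphs *)

Lemma c_lt_deg v : 0 < deg v -> c v < deg v.
Proof. by move=> d_gt0; have := cE v; nia. Qed.

Definition divisible_subgraph := exists F : rel V,
  [/\ symmetric F, subrel F h, forall v, k %| #|[set u | F v u]|
    & exists v, 0 < #|[set u | F v u]|].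

Hypothesis dvdk : forall v, k %| deg v - c v.

(** The set [L] need not be the whole gadget: at a vertex where all ports are
    used up by cores, the subgraph has degree 0. *)
Lemma divisible_from_matching L :
    L \subset gadget -> perfectly_matchable gadget_rel L ->
    (forall v, ports L v = cores L v \/ ports L v = cores L v + (deg v - c v)) ->
    (exists v, cores L v < ports L v) ->
  divisible_subgraph.
Proof.
move=> sLG pmL fibL [v ltv]; have [F [symF sFh degF]] := extract_subgraph sLG pmL.
exists F; split=> // [u|]; last by exists v; have := degF v; lia.
have := degF u; case: (fibL u) => [->|-> E].
  by rewrite -[RHS]add0n => /addIn->; rewrite dvdn0.
by have -> : #|[set u0 | F u u0]| = deg u - c u by lia.
Qed.

Lemma match_heavy_blocks A P (good : pred {set node}) :
    critical_decomposition gadget_rel gadget A P ->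
    {in P, forall K, ~~ good K ->
       1 <= \sum_(x in K) \sum_(y in gadget :\: K) weight x y}%R ->
  exists Q : {set {set node}}, [/\ Q \subset P, {in Q, forall K, good K}
    & perfectly_matchable gadget_rel (gadget :\: cover Q)].
Proof.
move=> dec heavy.
have [|Q [sQP goodQ _ pmQ]] :=
    @match_up_to_good _ gadget_rel gadget_rel_sym gadget_rel_irr gadget A P good dec; last by exists Q.
move=> Z sZP badZ; apply: (fractional_hall (w := weight) dec) => //.
- by apply: weight_ge0; rewrite thetaE divr_ge0 ?ler0n.
- exact: weight_sym.
- exact: weight_out.
- by move=> x xG; rewrite weight_total.
by move=> K KZ; apply: heavy; [apply: (subsetP sZP) | apply: badZ].
Qed.

Lemma block_sub A P K : critical_decomposition gadget_rel gadget A P -> K \in P ->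
  K \subset gadget.
Proof.
move=> dec KP; apply: (@subset_trans _ _ (cover P)); first exact: bigcup_sup.
by rewrite (cd_cover dec) subsetDl.
Qed.

(** A good block contains the complete gadget of a vertex or nothing of it, so
    the unmatched blocks can be dropped. Something remains: an unmatched block
    is odd and therefore has an open port, whose partner lies in [A]. *)
Lemma divisible_of_odd : (forall v, ~~ odd (c v)) -> (exists v, 0 < deg v) -> divisible_subgraph.
Proof.
move=> c_even [v0 d0].
have [A [P dec]] := critical_decomposition_exists gadget_rel_sym gadget_rel_irr gadget.
pose good K := [forall v, (ports K v == 0) && (cores K v == 0)
                       || (ports K v == deg v) && (cores K v == c v)].
have [|Q [sQP goodQ pmQ]] := match_heavy_blocks dec (good := good).
  move=> K KP bad; have [//|[cores01 miss0]] :=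
    odd_block c_even (block_sub dec KP) (cd_odd dec KP).
  case/forallPn: bad => v; have := miss0 v; rewrite /missing.
  have := ports_le v (block_sub dec KP).
  case: (cores01 v) => ->; rewrite ?eqxx ?andbT; first by move=> _ -> ; rewrite eqxx.
  case: eqVneq => [_|c0] lep m0; first by rewrite m0 eqxx.
  by rewrite (_ : ports K v = deg v) ?eqxx ?orbT //; lia.
have sQG : cover Q \subset gadget.
  by apply/bigcupsP=> K /(subsetP sQP) KP; apply: block_sub dec KP.
have le_cover K v : K \in Q -> ports K v <= ports (cover Q) v /\ cores K v <= cores (cover Q) v.
  move=> KQ; have sK : K \subset cover Q by apply: bigcup_sup.
  by split; apply: subset_leq_card; apply/subsetP=> i; rewrite !inE; apply: (subsetP sK).
have fibQ v : (ports (cover Q) v = 0 /\ cores (cover Q) v = 0)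
           \/ (ports (cover Q) v = deg v /\ cores (cover Q) v = c v).
  have := ports_le v sQG; have := cores_le v sQG.
  have [/existsP[K /andP[KQ /andP[/eqP pK /eqP cK]]]|/existsPn none] :=
      boolP [exists K in Q, (ports K v == deg v) && (cores K v == c v)].
    by have := le_cover K v KQ; right; lia.
  have empty K : K \in Q -> ports K v = 0 /\ cores K v = 0.
    move=> KQ; have /forallP/(_ v) := goodQ K KQ.
    by have := none K; rewrite KQ /= => /negPf->; rewrite orbF => /andP[/eqP-> /eqP->].
  move=> _ _; left; split; apply/eqP; rewrite cards_eq0; apply/eqP/setP=> i;
    rewrite !inE; apply/bigcupP=> -[K KQ iK]; have [p0 c0] := empty K KQ.
    by have := cards0_eq p0 => /setP/(_ i); rewrite !inE iK.
  by have := cards0_eq c0 => /setP/(_ i); rewrite !inE iK.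
apply: (divisible_from_matching _ pmQ); first exact: subsetDl.
  move=> v; rewrite portsD // coresD //.
  by case: (fibQ v) => -[-> ->]; rewrite ?subnn; [right|left]; have := c_le v; lia.
case: (boolP [exists v, cores (gadget :\: cover Q) v < ports (gadget :\: cover Q) v]).
  by case/existsP=> v ltv; exists v.
move/existsPn=> none; exfalso.
(* Degree 0 everywhere would mean that all gadgets are dropped, [A] included. *)
have cov u v : h u v -> inl (u, v) \in cover Q.
  move=> huv; have d_gt0 : 0 < deg u by apply/card_gt0P; exists v; rewrite inE.
  have full : ports (cover Q) u = deg u.
    have := none u; have := c_lt_deg d_gt0; rewrite portsD // coresD //.
    by case: (fibQ u) => -[-> ->]; lia.
  have /eqP : [set w | inl (u, w) \in cover Q] == [set w | h u w].
    rewrite eqEcard -/(ports (cover Q) u) full leqnn andbT; apply/subsetP=> w; rewrite !inE.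
    by move/(subsetP sQG); rewrite inE.
  by move/setP/(_ v); rewrite !inE huv.
have [u0 hvu] : exists u0, h v0 u0 by case/card_gt0P: d0 => u0; rewrite inE; exists u0.
have /bigcupP[K KQ _] := cov _ _ hvu; have KP := subsetP sQP K KQ.
have cores01 v : cores K v = 0 \/ cores K v = c v.
  have /forallP/(_ v) := goodQ K KQ.
  by case/orP=> /andP[_ /eqP]; [left|right].
have := odd_open_odd_block c_even cores01 (block_sub dec KP) (cd_odd dec KP).
case: (set_0Vmem (open_ports K)) => [->|[[u v]]]; first by rewrite cards0.
rewrite inE /= => /andP[uvK vuK] _.
have huv : h u v by have := subsetP (block_sub dec KP) _ uvK; rewrite inE.
have hvu' : h v u by rewrite symh.
have vuG : inl (v, u) \in gadget by rewrite inE.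
have euv : gadget_rel (inl (u, v)) (inl (v, u)) by rewrite /= huv eqxx.
have := cd_sep dec KP uvK vuG euv; rewrite inE (negPf vuK) /= => vuA.
have /bigcupP[K' /(subsetP sQP) K'P vuK'] := cov _ _ hvu'.
have : inl (v, u) \in cover P by apply/bigcupP; exists K'.
by rewrite (cd_cover dec) inE vuA.
Qed.

Lemma ports_cores_D1_port K v u w : inl (v, u) \in K ->
  ports (K :\ inl (v, u)) w = ports K w - (w == v) /\ cores (K :\ inl (v, u)) w = cores K w.
Proof.
move=> vuK; split; last by apply: eq_card => i; rewrite !inE.
case: eqVneq => [->|wv] /=; last first.
  by rewrite subn0; apply: eq_card => i; rewrite !inE (inj_eq inl_inj) xpair_eqE (negPf wv).
rewrite /ports (cardsD1 u [set u0 | _ \in K]) inE vuK add1n subn1 /=.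
by apply: eq_card => i; rewrite !inE (inj_eq inl_inj) xpair_eqE eqxx.
Qed.

Lemma ports_cores_D1_core K v i w : inr (v, i) \in K ->
  ports (K :\ inr (v, i)) w = ports K w /\ cores (K :\ inr (v, i)) w = cores K w - (w == v).
Proof.
move=> viK; split; first by apply: eq_card => u; rewrite !inE.
case: eqVneq => [->|wv] /=; last first.
  by rewrite subn0; apply: eq_card => j; rewrite !inE (inj_eq inr_inj) xpair_eqE (negPf wv).
rewrite /cores (cardsD1 i [set j | _ \in K]) inE viK add1n subn1 /=.
by apply: eq_card => j; rewrite !inE (inj_eq inr_inj) xpair_eqE eqxx.
Qed.

(** If no block is light, the gadget has a perfect matching. A light block is
    the union of complete gadgets up to one port, at [v1]. If that port is the
    only node at [v1] in the block, remove it; if it is the only node at [v1]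
    outside, remove a core of [v1] instead, which restores the difference
    between ports and cores. Either way factor-criticality gives a perfect
    matching of what is left. *)
Lemma divisible_of_even :
    (forall v, odd (c v) = odd (deg v)) -> 3 * k <= 2 * q -> (exists v, 0 < deg v) ->
  divisible_subgraph.
Proof.
move=> c_par le32 [v0 d0].
have [A [P dec]] := critical_decomposition_exists gadget_rel_sym gadget_rel_irr gadget.
have [/existsP[K /andP[KP light]]|/existsPn heavy] := boolP [exists K in P,
    ~~ (1 <= \sum_(x in K) \sum_(y in gadget :\: K) weight x y)%R]; last first.
  have [K KP _|Q [_ noQ pmQ]] := match_heavy_blocks dec (good := pred0).
    by have := heavy K; rewrite KP /= negbK.
  have Q0 : Q = set0 by apply/setP=> K; rewrite inE; apply/negP=> /noQ.
  rewrite Q0 /cover big_set0 setD0 in pmQ.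
  apply: (divisible_from_matching (subxx _) pmQ) => [v|].
    by rewrite ports_gadget cores_gadget; right; have := c_le v; lia.
  by exists v0; rewrite ports_gadget cores_gadget c_lt_deg.
have sKG := block_sub dec KP.
have [/negPn|[cores01 miss1 closed]] := even_block c_par le32 sKG (cd_odd dec KP).
  by rewrite light.
have /eqP/sum_nat_eq1[v1 [_ miss_v1 miss_others]] := miss1.
have others v : v != v1 ->
    (ports K v = 0 /\ cores K v = 0) \/ (ports K v = deg v /\ cores K v = c v).
  move=> vv1; have := miss_others v vv1 isT; rewrite /missing; have := ports_le v sKG.
  by case: eqVneq => [-> _ ->|c0 lep m0]; [left | right; case: (cores01 v) => cv; lia].
move: miss_v1; rewrite /missing; case: eqVneq => [no_core one_port|some_core one_missing].
  (* [inl (v1, u)] is the single port; the opposite vertex [u] has its complete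
     gadget in [K], because no port of [K] is open. *)
  have [u uK] : exists u, inl (v1, u) \in K.
    have : 0 < ports K v1 by rewrite one_port.
    by case/card_gt0P=> u; rewrite inE; exists u.
  have [p' c'] : ports (K :\ inl (v1, u)) v1 = 0 /\ cores (K :\ inl (v1, u)) v1 = 0.
    by have [-> ->] := ports_cores_D1_port v1 uK; rewrite eqxx one_port no_core.
  have pmL : perfectly_matchable gadget_rel (K :\ inl (v1, u)) by apply: (cd_critical dec KP).
  apply: (divisible_from_matching _ pmL).
  - by apply: subset_trans sKG; apply: subsetDl.
  - move=> v; have [E1 E2] := ports_cores_D1_port v uK.
    have [->|vv1] := eqVneq v v1; first by rewrite p' c'; left.
    rewrite E1 E2 (negPf vv1) subn0; have := c_le v.
    by case: (others v vv1) => -[-> ->]; [left|right; lia].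
  have uv1K : inl (u, v1) \in K.
    have : (v1, u) \notin open_ports K by rewrite closed inE.
    by rewrite inE uK /= negbK.
  have huv : h u v1 by have := subsetP sKG _ uv1K; rewrite inE.
  have uv1 : u != v1 by apply: contraTneq huv => ->; rewrite irrh.
  exists u; have [-> ->] := ports_cores_D1_port u uK; rewrite (negPf uv1) subn0.
  have : 0 < ports K u by apply/card_gt0P; exists v1; rewrite inE.
  have d_gt0 : 0 < deg u by apply/card_gt0P; exists v1; rewrite inE.
  by have := c_lt_deg d_gt0; case: (others u uv1) => -[-> ->].
have [i iK] : exists i, inr (v1, i) \in K.
  have : 0 < cores K v1 by rewrite lt0n.
  by case/card_gt0P=> i; rewrite inE; exists i.
have all_cores : cores K v1 = c v1 by case: (cores01 v1) some_core => ->.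
have pmL : perfectly_matchable gadget_rel (K :\ inr (v1, i)) by apply: (cd_critical dec KP).
apply: (divisible_from_matching _ pmL).
- by apply: subset_trans sKG; apply: subsetDl.
- move=> v; have [-> ->] := ports_cores_D1_core v iK.
  have [->|vv1] := eqVneq v v1; first by have := c_le v1; right; lia.
  by rewrite subn0; have := c_le v; case: (others v vv1) => -[-> ->]; [left|right; lia].
exists v1; have [-> ->] := ports_cores_D1_core v1 iK; rewrite eqxx.
by have := @c_lt_deg v1; lia.
Qed.

End Gadget.

(** * Divisible sets of edges modulo a prime *)

Section AlternatingSum.
Local Open Scope ring_scope.

(** A product of fewer than |E| affine functions of the indicator of [S] is
    orthogonal to the sign (-1)^|S|. The lower bound [S0] on [S] makes the
    induction on the number of factors work: multiplying by the indicator of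
    [i \in S] amounts to adding [i] to [S0]. *)
Lemma alternating_sum_eq0 (I : finType) (R : comNzRingType) (E S0 : {set I})
    (s : seq (R * (I -> R))) :
    S0 \subset E -> (#|S0| + size s < #|E|)%N ->
  \sum_(S : {set I} | (S0 \subset S) && (S \subset E))
     (-1) ^+ #|S| * \prod_(l <- s) (l.1 + \sum_(i in S) l.2 i) = 0.
Proof.
elim: s S0 => [|[r a] s IHs] S0 sS0E /= lt_size.
  have [f fE fS0] : exists2 f, f \in E & f \notin S0.
    apply/subsetPn; apply: contraTN lt_size => sES0.
    by rewrite addn0 -leqNgt subset_leq_card.
  (* Without factors, toggling [f] cancels the terms in pairs. *)
  rewrite (bigID (fun S : {set I} => f \in S)) /=.
  rewrite (reindex_onto (fun S => f |: S) (fun S => S :\ f)) /=; last first.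
    by move=> S /andP[_ fS]; rewrite setD1K.
  rewrite [X in X + _](eq_bigl (fun S : {set I} =>
    (S0 \subset S) && (S \subset E) && (f \notin S))); last first.
    move=> S; rewrite setU11 andbT subUset sub1set fE /=.
    have [fS|fS] := boolP (f \in S).
      rewrite andbF; apply/negP=> /andP[_ /eqP SE].
      by have := setD11 f (f |: S); rewrite SE fS.
    rewrite setU1K // eqxx !andbT; congr (_ && _).
    apply/idP/idP=> [/subsetP sS|/subset_trans-> //]; last exact: subsetUr.
    apply/subsetP=> x xS0; have := sS x xS0; rewrite !inE.
    by case: eqVneq => // xf; rewrite xf (negPf fS0) in xS0.
  rewrite -big_split big1 //= => S /andP[_ fS].
  by rewrite cardsU1 fS !big_nil exprS !mulr1 mulN1r addNr.
under eq_bigr => S _ do rewrite big_cons /= mulrDl mulrDr.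
rewrite big_split /= [X in X + _ = _](_ : _ = r * 0); last first.
  apply: etrans (congr1 ( *%R r) (IHs S0 sS0E _)).
    rewrite mulr_sumr.
    by apply: eq_bigr => S _; rewrite mulrCA.
  by apply: leq_ltn_trans lt_size; rewrite leq_add2l.
rewrite mulr0 add0r.
transitivity (\sum_(f in E) a f *
   \sum_(S : {set I} | (f |: S0 \subset S) && (S \subset E))
     (-1) ^+ #|S| * \prod_(l <- s) (l.1 + \sum_(i in S) l.2 i)); last first.
  rewrite big1 // => f fE; rewrite IHs ?mulr0 //.
    by rewrite subUset sub1set fE.
  apply: leq_ltn_trans lt_size; rewrite addnS -addSn leq_add2r cardsU1.
  by rewrite -add1n leq_add2r leq_b1.
under [RHS]eq_bigr => f _ do rewrite mulr_sumr.
rewrite (exchange_big_dep (fun S : {set I} => (S0 \subset S) && (S \subset E))) /=; last first.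
  by move=> f S _ /andP[]; rewrite subUset => /andP[_ ->].
apply: eq_bigr => S /andP[sS0S sSE].
rewrite mulr_suml mulr_sumr; apply: eq_big => f; last by rewrite mulrCA.
rewrite subUset sub1set sS0S sSE !andbT.
by have [/(subsetP sSE)->|] := boolP (f \in S); rewrite ?andbF.
Qed.

(** The product over all v and all a <> 0 of a - d_S(v), in the field with p
    elements, vanishes unless [S] is divisible by [p] at all vertices of [W],
    and it is nonzero for the empty set. *)
Theorem exists_divisible_subset (V : finType) (E : {set {set V}}) (W : {set V}) p :
    prime p -> ((p - 1) * #|W| < #|E|)%N ->
  exists S : {set {set V}}, [/\ S \subset E, S != set0
    & {in W, forall v, (p %| #|[set f in S | v \in f]|)%N}].
Proof.
move=> pr_p ltE; pose deg_in (S : {set {set V}}) v := #|[set f in S | v \in f]|.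
have [/existsP[S /and3P[sSE S0 /forall_inP dvdS]]|/existsPn none] := boolP [exists S : {set {set V}},
  [&& S \subset E, S != set0 & [forall v in W, (p %| deg_in S v)%N]]].
  by exists S.
pose s : seq ('F_p * ({set V} -> 'F_p)) :=
  [seq (a, fun f : {set V} => if v \in f then -1 else 0)
     | v <- enum W, a <- enum [set~ (0 : 'F_p)]].
have sE (S : {set {set V}}) :
    \prod_(l <- s) (l.1 + \sum_(f in S) l.2 f)
      = \prod_(v in W) \prod_(a in [set~ (0 : 'F_p)]) (a - (deg_in S v)%:R).
  rewrite /s big_allpairs_dep /= big_enum; apply: eq_bigr => v _.
  rewrite big_enum; apply: eq_bigr => a _; congr (_ + _).
  rewrite -big_mkcondr sumr_const -[RHS]mulN1r mulr_natr; congr (_ *+ _).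
  by apply: eq_card => f; rewrite !inE.
have size_s : size s = ((p - 1) * #|W|)%N.
  rewrite size_allpairs -!cardE cardsC1 card_Fp // subn1 mulnC //.
have := @alternating_sum_eq0 {set V} 'F_p E set0 s (sub0set _).
rewrite cards0 add0n size_s => /(_ ltE).
rewrite (bigD1 set0) ?sub0set //= [X in _ + X]big1 => [|S]; last first.
  rewrite sub0set /= => /andP[sSE S0].
  have := none S; rewrite sSE S0 /= => /forall_inPn[v vW ndvd].
  rewrite sE (bigD1 v) //= (bigD1 (deg_in S v)%:R) /=.
    by rewrite subrr !(mul0r, mulr0).
  by rewrite !inE -(dvdn_pcharf (pchar_Fp pr_p)).
move/eqP; rewrite addr0 cards0 expr0 mul1r sE => /eqP prod0.
suff : \prod_(v in W) \prod_(a in [set~ (0 : 'F_p)]) (a - (deg_in set0 v)%:R) != 0.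
  by rewrite prod0 eqxx.
apply/prodf_neq0 => v _; apply/prodf_neq0 => a.
rewrite !inE (_ : deg_in set0 v = 0%N) ?subr0 //.
by apply/eqP; rewrite cards_eq0; apply/eqP/setP=> f; rewrite !inE.
Qed.

End AlternatingSum.

(** * The bound on the number of edges *)

(** With c(v) = (q - k)d(v)/q, the numbers c(v) are even for odd [k], and have
    the parity of d(v) for even [k], because d(v) - c(v) = k d(v)/q. *)
Lemma divisible_subgraph_exists (V : finType) (h : rel V) (q k : nat) :
    symmetric h -> irreflexive h -> odd q -> 0 < k -> k < q ->
    odd k || (3 * k <= 2 * q) ->
    (forall v, q %| deg h v) -> (exists v, 0 < deg h v) ->
  divisible_subgraph h k.
Proof.
move=> symh irrh odd_q k_gt0 ltkq k_ok q_dvd nonempty.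
pose c v := (q - k) * (deg h v %/ q).
have degE v : deg h v = q * (deg h v %/ q) by rewrite mulnC divnK.
have cE v : q * c v = (q - k) * deg h v by rewrite /c [in RHS]degE mulnCA.
have fE v : deg h v - c v = k * (deg h v %/ q).
  by rewrite {1}degE /c -mulnBl subKn // ltnW.
have c_le v : c v <= deg h v by rewrite [X in _ <= X]degE leq_mul2r leq_subr orbT.
have dvdk v : k %| deg h v - c v by rewrite fE dvdn_mulr.
have [odd_k|even_k] := boolP (odd k).
  apply: (divisible_of_odd symh irrh c_le k_gt0 ltkq cE erefl dvdk) => // v.
  by rewrite /c oddM oddB ?(ltnW ltkq) // odd_q odd_k.
rewrite (negPf even_k) /= in k_ok.
apply: (divisible_of_even symh irrh c_le k_gt0 ltkq cE erefl dvdk) => // v.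
have := congr1 odd (fE v); rewrite oddM (negPf even_k) oddB //=.
by case: (odd (c v)); case: (odd _).
Qed.

Lemma card_incident (V : finType) (S : {set {set V}}) (v : V) :
    {in S, forall f : {set V}, #|f| = 2} ->
  #|[set f in S | v \in f]| = #|[set u | [set v; u] \in S]|.
Proof.
move=> S2; have inj : {in [set u | [set v; u] \in S] &, injective (fun u => [set v; u])}.
  move=> u w; rewrite !inE => /S2; rewrite cards2; case: eqVneq => // vu _.
  move=> /S2; rewrite cards2; case: eqVneq => // vw _ /setP/(_ w).
  by rewrite !inE eqxx orbT => /orP[/eqP wv|/eqP->//]; rewrite wv eqxx in vw.
rewrite -(card_in_imset inj); apply: eq_card => f; rewrite inE; apply/andP/imsetP.
  case=> fS vf; have /eqP/cards2P[x [y [_ fE]]] := S2 f fS.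
  move: vf fS; rewrite fE => /set2P[]-> xyS; first by exists y; rewrite ?inE.
  by exists x; rewrite ?inE setUC.
by case=> u; rewrite inE => uS ->; rewrite uS set21.
Qed.

Lemma divisible_edge_subset (V : finType) (S : {set {set V}}) (q k : nat) :
    {in S, forall f : {set V}, #|f| = 2} -> S != set0 ->
    (forall v, q %| #|[set f in S | v \in f]|) ->
    odd q -> 0 < k -> k <= q -> odd k || (3 * k <= 2 * q) ->
  exists S' : {set {set V}},
    [/\ S' \subset S, S' != set0 & forall v, k %| #|[set f in S' | v \in f]|].
Proof.
move=> S2 S0 q_dvd odd_q k_gt0; rewrite leq_eqVlt => /predU1P[->|ltkq] k_ok.
  by exists S.
pose h : rel V := fun u v => [set u; v] \in S.
have symh : symmetric h by move=> u v; rewrite /h setUC.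
have irrh : irreflexive h.
  by move=> u; apply/negP=> /S2; rewrite setUid cards1.
have degE v : deg h v = #|[set f in S | v \in f]| by rewrite card_incident.
have [||F [symF sFh dvdF [v F_gt0]]] :=
    divisible_subgraph_exists symh irrh odd_q k_gt0 ltkq k_ok.
- by move=> v; rewrite degE.
- have [f fS] := set0Pn _ S0; have /eqP/cards2P[x [y [_ fE]]] := S2 f fS.
  by exists x; apply/card_gt0P; exists y; rewrite inE /h -fE.
pose S' := [set f in S | [exists u, exists w, (f == [set u; w]) && F u w]].
have sS'S : S' \subset S by apply/subsetP=> f; rewrite inE => /andP[].
have S'E u w : ([set u; w] \in S') = F u w.
  rewrite inE; apply/andP/idP => [[_ /existsP[x /existsP[y /andP[/eqP xyE Fxy]]]]|Fuw].
    have xy : x != y by apply: contraTneq (sFh x y Fxy) => ->; rewrite irrh.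
    have : x \in [set u; w] by rewrite xyE set21.
    have : y \in [set u; w] by rewrite xyE set22.
    move=> /set2P[]yE /set2P[]xE; rewrite -?xE -?yE //; first by rewrite xE yE eqxx in xy.
      by rewrite symF.
    by rewrite xE yE eqxx in xy.
  split; first exact: sFh.
  by apply/existsP; exists u; apply/existsP; exists w; rewrite eqxx.
have degS' u : #|[set f in S' | u \in f]| = #|[set w | F u w]|.
  rewrite card_incident; last by move=> f /(subsetP sS'S)/S2.
  by apply: eq_card => w; rewrite in_set S'E in_set.
exists S'; split=> // [|u]; last by rewrite degS'.
have [w] := card_gt0P F_gt0; rewrite inE -S'E => vwS'.
by apply/set0Pn; exists [set v; w].
Qed.

Lemma edge_bound (k q : nat) (T : finType) (G : graph T) :
    0 < k -> k <= q -> prime q -> odd q -> odd k || (3 * k <= 2 * q) ->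
    ~ (exists H : graph T, [/\ subgraph H G, nonempty_graph H & divisible_graph k H]) ->
  num_edges G <= (q - 1) * #|vertices G|.
Proof.
move=> k_gt0 lekq pr_q odd_q k_ok noH; rewrite leqNgt; apply/negP=> ltE; apply: noH.
have [S [sSE S0 q_dvd]] := exists_divisible_subset pr_q ltE.
have S2 : {in S, forall f : {set T}, f \subset vertices G /\ #|f| = 2}.
  by move=> f /(subsetP sSE)/edgesP.
have [|//|v|//|//|//|//|S' [sS'S S'0 k_dvd]] := @divisible_edge_subset T S q k.
- by move=> f /S2[].
- have [vG|vG] := boolP (v \in vertices G); first exact: q_dvd.
  rewrite (_ : #|_| = 0) ?dvdn0 //; apply/eqP; rewrite cards_eq0; apply/eqP/setP=> f.
  rewrite !inE; apply/negP=> /andP[/S2[/subsetP sf _] /sf].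
  by rewrite (negPf vG).
have S'P : {in S', forall f : {set T}, f \subset vertices G /\ #|f| = 2}.
  by move=> f /(subsetP sS'S)/S2.
exists (Graph S'P); split=> // [|v _]; last by apply/eqP; rewrite mod0n; apply: k_dvd.
by split=> //; apply: subset_trans sSE.
Qed.

Lemma next_primeP (R : realType) (x : R) :
  prime (next_prime x) /\ (x <= (next_prime x)%:R)%R.
Proof. by rewrite /next_prime; case: ex_minnP => p /andP[]. Qed.

Theorem lemma5 (R : realType) (k : nat) (hk : 2 <= k)
    (n : nat) (T : finType) (G : graph T) (hn : #|vertices G| = n)
    (hG : ~ exists H : graph T,
        [/\ subgraph H G, nonempty_graph H & divisible_graph k H]) :
  num_edges G <= (next_prime ((3 * k%:R / 2)%R : R) - 1) * n /\
  (odd k -> num_edges G <= (next_prime (k%:R%R : R) - 1) * n).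
Proof.
rewrite -hn; have k_gt0 : 0 < k by apply: ltnW.
split=> [|odd_k].
  have [pr_q] := next_primeP (3 * k%:R / 2 : R)%R; set q := next_prime _ in pr_q *.
  rewrite ler_pdivrMr ?ltr0n // -!natrM ler_nat => le32.
  apply: edge_bound hG => //; [by lia | | by rewrite (mulnC 2) le32 orbT].
  by case/even_prime: pr_q => // q2; rewrite q2 in le32; lia.
have [pr_q] := next_primeP (k%:R : R)%R; set q := next_prime _ in pr_q *.
rewrite ler_nat => lekq; apply: edge_bound hG => //; last by rewrite odd_k.
case/even_prime: pr_q => // q2; have k2 : k = 2 by lia.
by rewrite k2 in odd_k.
Qed.
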